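(* Let $S$ be a semigroup, let $\sigma:S\to S$ be an involutive automorphism, and let $\alpha\in\mathbb{C}$ be a fixed constant. The solutions $g,f:S\to\mathbb{C}$ of the functional equation $$g(x\sigma(y))=g(x)g(y)-f(x)f(y)+\alpha f(x\sigma(y)),\quad x,y\in S,$$ are exactly the pairs in the following families: (1) $\alpha=\pm1$, $f$ is any non-zero function and $g=\alpha f$. (2) $\alpha\neq 1$, $f=g\neq 0$ and $g=0$ on $S^2$. (3) $\alpha\neq -1$, $f=-g\neq 0$ and $g=0$ on $S^2$. (4) $f=(q+\alpha)\dfrac{\chi}{2}$ and $g=\left(1\pm\sqrt{1+q^2-\alpha^2}\right)\dfrac{\chi}{2}$, where $q\in\mathbb{C}$ is a constant and $\chi:S\to\mathbb{C}$ is a non-zero even multiplicative function. (5) $f=\alpha\dfrac{\chi_1+\chi_2}{2}+q\dfrac{\chi_1-\chi_2}{2}$ and $g=\dfrac{\chi_1+\chi_2}{2}\pm\sqrt{1+q^2-\alpha^2}\,\dfrac{\chi_1-\chi_2}{2}$, where $\chi_1,\chi_2:S\to\mathbb{C}$ are two different non-zero even multiplicative functions and $q\in\mathbb{C}\setminus\{\pm\alpha\}$ is a constant. (6) $\alpha\neq 0$, $f=\alpha\chi_1$ and $g=\chi_2$, where $\chi_1,\chi_2:S\to\mathbb{C}$ are two different non-zero even multiplicative functions. (7) $f=\alpha\chi+h$ and $g=\chi\pm h$, where $$h=\begin{cases}\chi A & \text{on } S\setminus I_\chi,\\ 0 & \text{on } I_\chi\setminus P_\chi,\\ \rho & \text{on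 } P_\chi,\end{cases}$$ $\chi:S\to\mathbb{C}$ is an even non-zero multiplicative function, $A:S\setminus I_\chi\to\mathbb{C}$ is an additive function such that $A\circ\sigma=A$, and $\rho:P_\chi\to\mathbb{C}$ is a function such that $\rho\circ\sigma=\rho$; in addition the following conditions hold: (I) if $x\in\{up,pv,upv\}$ for $p\in P_\chi$ and $u,v\in S\setminus I_\chi$, then respectively $\rho(x)=\rho(p)\chi(u)$, $\rho(x)=\rho(p)\chi(v)$, or $\rho(x)=\rho(p)\chi(uv)$; (II) $h(xy)=h(yx)=0$ for all $x\in I_\chi\setminus P_\chi$ and $y\in S\setminus I_\chi$. (8) $\alpha\neq\pm1$, $f=\dfrac{1+\alpha}{2}\chi-\dfrac{1-\alpha}{2}\chi^*$ and $g=\dfrac{1+\alpha}{2}\chi+\dfrac{1-\alpha}{2}\chi^*$, where $\chi:S\to\mathbb{C}$ is a multiplicative function such that $\chi\neq\chi^*$. Off the exceptional case (1), $g$ and $f$ are abelian. Furthermore, for any solution $(g,f)$: if $S$ is a topological semigroup and $f\in C(S)$ is such that $f\neq\alpha\chi$ for any multiplicative function $\chi\in C(S)$, then $g\in C(S)$.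
   Context: An involutive automorphism of $S$ is a map $\sigma:S\to S$ with $\sigma(xy)=\sigma(x)\sigma(y)$ and $\sigma(\sigma(x))=x$ for all $x,y\in S$. A function $\chi:S\to\mathbb{C}$ is multiplicative if $\chi(xy)=\chi(x)\chi(y)$ for all $x,y\in S$. A function $a$ from a semigroup to $\mathbb{C}$ is additive if $a(xy)=a(x)+a(y)$ for all $x,y$ in that semigroup. For $f:S\to\mathbb{C}$, $f^*(x)=f(\sigma(x))$; $f$ is even if $f=f^*$. For a subset $T\subseteq S$, $T^2:=\{xy\mid x,y\in T\}$. For a non-zero multiplicative function $\chi:S\to\mathbb{C}$, $$I_\chi:=\{x\in S\mid\chi(x)=0\},$$ $$P_\chi:=\{p\in I_\chi\setminus I_\chi^2\mid up,\,pv,\,upv\in I_\chi\setminus I_\chi^2\ \text{for all}\ u,v\in S\setminus I_\chi\},$$ where $I_\chi^2=(I_\chi)^2$. If $\chi$ is even then $\sigma$ maps $S\setminus I_\chi$ onto itself and $P_\chi$ onto itself, so the conditions $A\circ\sigma=A$ and $\rho\circ\sigma=\rho$ make sense. A function $f:S\to\mathbb{C}$ is central if $f(xy)=f(yx)$ for all $x,y\in S$, and abelian if it is central and $f(xyz)=f(xzy)$ for all $x,y,z\in S$. For a topological semigroup $S$, $C(S)$ denotes the algebra of continuous functions from $S$ into $\mathbb{C}$. *)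

(* Defs.v *)
From HB Require Import structures.
From mathcomp Require Import all_boot all_order all_algebra.
From mathcomp Require Import complex.
From mathcomp Require Import all_classical all_reals all_analysis.

Set Implicit Arguments.
Unset Strict Implicit.
Unset Printing Implicit Defensive.

Import Order.TTheory GRing.Theory Num.Theory.
Import numFieldNormedType.Exports.

Local Open Scope classical_set_scope.
Local Open Scope ring_scope.

HB.mixin Record Semigroup_isTopological S of Semigroup S & Topological S := {
  mulg_continuous : continuous (fun xy : S * S => (xy.1 * xy.2)%g)
}.

#[short(type="topologicalSemigroupType")]
HB.structure Definition TopologicalSemigroup :=
  {S of Semigroup S & Topological S & Semigroup_isTopological S}.

(* R[i] itself carries no topology in the library; its copy R[i]^o has the
   topology of the complex modulus. *)
Definition continuousC (R : realType) (S : topologicalType) (f : S -> R[i]) :=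
  continuous (f : S -> R[i]^o).

Section Semigroup.
Variables (R : realType) (S : semigroupType).
Implicit Types (sigma : S -> S) (f g chi A rho h : S -> R[i]) (alpha q : R[i]).

Definition involutive_automorphism sigma :=
  {morph sigma : x y / (x * y)%g} /\ involutive sigma.

Definition multiplicative_fun chi :=
  forall x y, chi (x * y)%g = chi x * chi y.

Definition star sigma f : S -> R[i] := f \o sigma.

Definition even_fun sigma f := f = star sigma f.

Definition nonzero_fun f := f <> cst 0.

Definition central_fun f := forall x y, f (x * y)%g = f (y * x)%g.

Definition abelian_fun f :=
  central_fun f /\ forall x y z, f (x * y * z)%g = f (x * z * y)%g.

Definition sqr_set (T : set S) : set S := [set (x * y)%g | x in T & y in T].

Definition I_ chi : set S := [set x | chi x = 0].

Definition P_ chi : set S :=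
  [set p | (I_ chi `\` sqr_set (I_ chi)) p /\
    forall u v, (~` I_ chi) u -> (~` I_ chi) v ->
      [/\ (I_ chi `\` sqr_set (I_ chi)) (u * p)%g,
          (I_ chi `\` sqr_set (I_ chi)) (p * v)%g &
          (I_ chi `\` sqr_set (I_ chi)) (u * p * v)%g]].

Definition solution sigma alpha g f :=
  forall x y, g (x * sigma y)%g =
    g x * g y - f x * f y + alpha * f (x * sigma y)%g.

(* A partial function on a subset of S is represented by a total function of
   which only the values on that subset are used: A on ~` I_ chi, rho on
   P_ chi. *)
Definition h_fun chi A rho : S -> R[i] := fun x =>
  if x \in ~` I_ chi then chi x * A x
  else if x \in P_ chi then rho x
  else 0.

Definition additive_on (T : set S) A :=
  forall x y, T x -> T y -> A (x * y)%g = A x + A y.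

Definition invariant_on (T : set S) sigma A :=
  forall x, T x -> A (sigma x) = A x.

Definition condition_I chi rho :=
  forall p u v, P_ chi p -> (~` I_ chi) u -> (~` I_ chi) v ->
    [/\ rho (u * p)%g = rho p * chi u,
        rho (p * v)%g = rho p * chi v &
        rho (u * p * v)%g = rho p * chi (u * v)%g].

Definition condition_II chi h :=
  forall x y, (I_ chi `\` P_ chi) x -> (~` I_ chi) y ->
    h (x * y)%g = 0 /\ h (y * x)%g = 0.

Definition family1 alpha g f :=
  [/\ alpha = 1 \/ alpha = - 1,
      nonzero_fun f &
      forall x, g x = alpha * f x].

Definition family2 alpha g f :=
  [/\ alpha <> 1, f = g, nonzero_fun g &
      forall x, sqr_set setT x -> g x = 0].

Definition family3 alpha g f :=
  [/\ alpha <> - 1, (forall x, f x = - g x), nonzero_fun g &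
      forall x, sqr_set setT x -> g x = 0].

(* In families 4, 5 and 7 the boolean b encodes the sign in front of the
   square root, respectively of h. *)
Definition family4 sigma alpha g f :=
  exists (q : R[i]) (b : bool) (chi : S -> R[i]),
  [/\ nonzero_fun chi, multiplicative_fun chi, even_fun sigma chi,
      forall x, f x = (q + alpha) * (chi x / 2) &
      forall x, g x =
        (1 + (-1) ^+ b * sqrtC (1 + q ^+ 2 - alpha ^+ 2)) * (chi x / 2)].

Definition family5 sigma alpha g f :=
  exists (q : R[i]) (b : bool) (chi1 chi2 : S -> R[i]),
  [/\ (chi1 <> chi2 /\ q <> alpha /\ q <> - alpha),
      [/\ nonzero_fun chi1, multiplicative_fun chi1 & even_fun sigma chi1],
      [/\ nonzero_fun chi2, multiplicative_fun chi2 & even_fun sigma chi2],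
      forall x, f x =
        alpha * ((chi1 x + chi2 x) / 2) + q * ((chi1 x - chi2 x) / 2) &
      forall x, g x = (chi1 x + chi2 x) / 2 +
        (-1) ^+ b * sqrtC (1 + q ^+ 2 - alpha ^+ 2) * ((chi1 x - chi2 x) / 2)].

Definition family6 sigma alpha g f :=
  exists chi1 chi2 : S -> R[i],
  [/\ (alpha <> 0 /\ chi1 <> chi2),
      [/\ nonzero_fun chi1, multiplicative_fun chi1 & even_fun sigma chi1],
      [/\ nonzero_fun chi2, multiplicative_fun chi2 & even_fun sigma chi2],
      forall x, f x = alpha * chi1 x &
      g = chi2].

Definition family7 sigma alpha g f :=
  exists (b : bool) (chi A rho : S -> R[i]),
  let h := h_fun chi A rho in
  [/\ [/\ nonzero_fun chi, multiplicative_fun chi & even_fun sigma chi],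
      additive_on (~` I_ chi) A /\ invariant_on (~` I_ chi) sigma A,
      invariant_on (P_ chi) sigma rho,
      condition_I chi rho /\ condition_II chi h &
      (forall x, f x = alpha * chi x + h x) /\
      (forall x, g x = chi x + (-1) ^+ b * h x)].

Definition family8 sigma alpha g f :=
  exists chi : S -> R[i],
  [/\ (alpha <> 1 /\ alpha <> - 1),
      multiplicative_fun chi, chi <> star sigma chi,
      forall x, f x =
        (1 + alpha) / 2 * chi x - (1 - alpha) / 2 * star sigma chi x &
      forall x, g x =
        (1 + alpha) / 2 * chi x + (1 - alpha) / 2 * star sigma chi x].

Definition families2to8 sigma alpha g f :=
  family2 alpha g f \/ family3 alpha g f \/
  family4 sigma alpha g f \/ family5 sigma alpha g f \/
  family6 sigma alpha g f \/ family7 sigma alpha g f \/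
  family8 sigma alpha g f.

End Semigroup.

(* Main.v *)
Require Import Defs.
From mathcomp Require Import all_boot all_order all_algebra.
From mathcomp Require Import complex.
From mathcomp Require Import all_classical all_reals all_analysis.
From mathcomp Require Import ring.

Import Order.TTheory GRing.Theory Num.Theory.
Import numFieldNormedType.Exports.

Local Open Scope classical_set_scope.
Local Open Scope ring_scope.

(** Put F = g - alpha f and let K((g1,f1),(g2,f2)) = g1 g2 - f1 f2, a
    nondegenerate symmetric bilinear form on the plane.  With w = (g,f), the
    equation says F (x sigma(y)) = K(w x, w y), and F x = K(kappa, w x) for
    the vector kappa = (1, alpha).

    If g and f are proportional, the equation reduces to one for a single
    function w, of the form A w(x sigma(y)) = B w(x) w(y), and the vanishing or
    not of A and B gives families 1 to 4 ([dependent_solution]).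

    If they are independent, the values of w span the plane.  The symmetry of
    K makes F (x y z) invariant under cyclic permutations, and F (x y z) is a
    linear function of w x, hence of each of w x, w y, w z.  Its antisymmetric
    part is therefore an alternating trilinear form on a plane, that is, zero
    ([alternating_trilinear_dim2]).  So F (x y z) is symmetric, which makes
    multiplication of arguments act on the values of w as a commutative algebra
    structure on the plane with unit kappa ([quadratic_structure]).  A
    two-dimensional commutative unital algebra over the complex numbers is
    either C x C or the dual numbers.  In the first case g and f are
    combinations of two characters ([spectral_form]); in the second they are
    combinations of a character chi and a function r with
    r (x y) = r x chi y + chi x r y.  As kappa is the unit, the coefficients of
    the two characters sum to kappa, respectively that of chi is kappa.

    Comparing coefficients in the equation then tells how sigma acts.  It
    fixes or exchanges the two characters, giving families 5, 6 and 8
    ([two_character_solution]); it fixes chi and r, giving family 7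
    ([character_sine_solution]), once solutions of the sine addition law are
    described by their values off the null ideal of chi and on P_chi
    ([sine_law_h_fun], with converse [h_fun_sine_law]).

    For the continuity statement, unless f is a multiple of a single character,
    the characters in the formulas for f and g are combinations of f and a
    right translate of f, hence continuous, and g is a combination of these
    characters and f. *)

(** * Linear independence of two functions *)

Section Independence.
Context {R : realType} {T : Type}.
Implicit Types (u v : T -> R[i]) (a b c d : R[i]).

(** A nonzero 2 x 2 minor of values: this amounts to linear independence of u
    and v, and it provides the two points at which linear systems are solved. *)
Definition independent u v :=
  exists z1 z2, u z1 * v z2 - u z2 * v z1 != 0.

(** Certificates for polynomial consequences of one or two equations: k and l
    are the cofactors, and the remaining identity is left to [ring]. *)
Lemma eq_of_lincomb1 a b k x y : a = b -> x - y = k * (a - b) -> x = y.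
Proof. by move=> -> /eqP; rewrite subrr mulr0 subr_eq0 => /eqP. Qed.

Lemma eq_of_lincomb2 a b c d k l x y :
  a = b -> c = d -> x - y = k * (a - b) + l * (c - d) -> x = y.
Proof. by move=> -> -> /eqP; rewrite !subrr !mulr0 addr0 subr_eq0 => /eqP. Qed.

Lemma independent_coef u v a b c d : independent u v ->
  (forall x, a * u x + b * v x = c * u x + d * v x) -> a = c /\ b = d.
Proof.
move=> [z1 [z2 nz]] e; split; apply: (mulIf nz).
  by apply: (eq_of_lincomb2 _ _ _ _ (v z2) (- v z1) _ _ (e z1) (e z2)); ring.
by apply: (eq_of_lincomb2 _ _ _ _ (- u z2) (u z1) _ _ (e z1) (e z2)); ring.
Qed.

Lemma independent_change u v u' v' a b c d :
  (forall x, u x = a * u' x + b * v' x) ->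
  (forall x, v x = c * u' x + d * v' x) ->
  independent u v -> independent u' v'.
Proof.
move=> eu ev [z1 [z2 nz]]; exists z1, z2; apply: contra_neq nz => e.
rewrite !eu !ev.
transitivity ((a * d - b * c) * (u' z1 * v' z2 - u' z2 * v' z1)); first by ring.
by rewrite e mulr0.
Qed.

Lemma independent_neq u v : independent u v -> u <> v.
Proof. by move=> [z1 [z2 /eqP nz]] e; apply: nz; rewrite e; ring. Qed.

Lemma independent_nonzero u v :
  independent u v -> u <> cst 0 /\ v <> cst 0.
Proof.
by move=> [z1 [z2 /eqP nz]]; split=> e; apply: nz; rewrite e /cst /=; ring.
Qed.

Lemma nonzero_fun_witness u : u <> cst 0 -> exists x, u x != 0.
Proof.
move=> u0; apply: contrapT => n; apply: u0; apply/funext => x.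
by apply/eqP; apply: contra_notT n => nz; exists x.
Qed.

Lemma dependent_multiple u v : ~ independent u v ->
  (u = cst 0 /\ v = cst 0) \/
  exists w a b, [/\ w <> cst 0, a != 0 \/ b != 0,
    forall x, u x = a * w x & forall x, v x = b * w x].
Proof.
move=> dep.
have det0 x y : u x * v y = u y * v x.
  apply/eqP; rewrite -subr_eq0; apply: contra_notT dep => nz.
  by exists x, y.
have [u0|/existsNP[z uz]] := pselect (forall x, u x = 0).
  have [v0|/existsNP[z vz]] := pselect (forall x, v x = 0).
    by left; split; apply/funext.
  right; exists v, 0, 1; split.
  - by move=> e; apply: vz; rewrite e.
  - by right; rewrite oner_neq0.
  - by move=> x; rewrite u0 mul0r.
  - by move=> x; rewrite mul1r.
right; exists u, 1, (v z / u z); split.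
- by move=> e; apply: uz; rewrite e.
- by left; rewrite oner_neq0.
- by move=> x; rewrite mul1r.
- move=> x; move/eqP: uz => uz; apply: (mulfI uz).
  by rewrite (det0 z x); field.
Qed.

(** An alternating trilinear form on a plane vanishes.  Linearity is only asked
    in the first argument, over the two points z1 and z2; the cyclic symmetry
    carries it to the others. *)
Lemma alternating_trilinear_dim2 (D : T -> T -> T -> R[i]) z1 z2 :
  (forall x y z, D x y z = D y z x) ->
  (forall x y z, D x y z = - D x z y) ->
  (forall x, exists c1 c2, forall y z,
     D x y z = c1 * D z1 y z + c2 * D z2 y z) ->
  forall x y z, D x y z = 0.
Proof.
move=> cyc anti lin.
have D0 (x y : T) : D y x x = 0.
  by apply: (eq_of_lincomb1 _ _ (1 / 2) _ _ (anti y x x)); field.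
have D0' (x y : T) : D x y x = 0 by rewrite cyc D0.
have D0'' (x y : T) : D x x y = 0 by rewrite cyc D0'.
have D12 x : D x z1 z2 = 0.
  by have [c1 [c2 ->]] := lin x; rewrite D0'' D0' !mulr0 addr0.
have D21 x : D x z2 z1 = 0 by rewrite anti D12 oppr0.
have D1 x y : D z1 x y = 0.
  rewrite cyc; have [c1 [c2 ->]] := lin x.
  by rewrite D0' (cyc z2) D12 !mulr0 addr0.
have D2 x y : D z2 x y = 0.
  rewrite cyc; have [c1 [c2 ->]] := lin x.
  by rewrite D0' (cyc z1) D21 !mulr0 addr0.
by move=> x y z; have [c1 [c2 ->]] := lin x; rewrite D1 D2 !mulr0 addr0.
Qed.

End Independence.

(** * Solutions with independent components *)

Definition sine_law {R : realType} {S : semigroupType} (chi h : S -> R[i]) :=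
  forall x y, h (x * y)%g = h x * chi y + chi x * h y.

Section Structure.
Context {R : realType} {S : semigroupType} {sigma : S -> S} {alpha : R[i]}.
Context {g f : S -> R[i]}.
Hypothesis sigmaP : involutive_automorphism sigma.
Hypothesis sol : solution sigma alpha g f.

Let F x : R[i] := g x - alpha * f x.
Let K x y : R[i] := g x * g y - f x * f y.

Let sigmaM x y : sigma (x * y)%g = (sigma x * sigma y)%g.
Proof. by case: sigmaP. Qed.

Let sigmaK x : sigma (sigma x) = x.
Proof. by case: sigmaP. Qed.

Let F_sigma x y : F (x * sigma y)%g = K x y.
Proof. by rewrite /F sol /K; ring. Qed.

Let K_sym x y : K x y = K y x.
Proof. by rewrite /K; ring. Qed.

(** The symmetry of K, read through [F_sigma]; reversing a triple product in its
    two bracketings gives [F_cyc]. *)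
Let F_rev x y : F (x * y)%g = F (sigma y * sigma x)%g.
Proof. by rewrite -{1}(sigmaK y) !F_sigma K_sym. Qed.

Let F_cyc x y z : F (x * y * z)%g = F (y * z * x)%g.
Proof.
by rewrite F_rev sigmaM mulgA -sigmaM -F_rev mulgA.
Qed.

Hypothesis indep : independent g f.

(** The difference of the two sides is an alternating trilinear form in
    (g x, f x), (g y, f y), (g z, f z). *)
Let F_sym3 x y z : F (x * y * z)%g = F (x * z * y)%g.
Proof.
have [z1 [z2 nz]] := indep.
pose D x y z : R[i] := F (x * y * z)%g - F (x * z * y)%g.
suff: D x y z = 0 by move/eqP; rewrite subr_eq0 => /eqP.
apply: (alternating_trilinear_dim2 D z1 z2) => [a b c|a b c|a].
- by rewrite /D F_cyc [in X in _ - X]F_cyc [in X in _ - X]F_cyc.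
- by rewrite /D [RHS]opprB.
exists ((g a * f z2 - g z2 * f a) / (g z1 * f z2 - g z2 * f z1)).
exists ((g z1 * f a - g a * f z1) / (g z1 * f z2 - g z2 * f z1)) => b c.
have FE u v w : F (u * v * w)%g = K u (sigma (v * w)%g).
  by rewrite -F_sigma sigmaK mulgA.
by rewrite /D !FE /K; field.
Qed.

(** Nondegeneracy of K on the span of the values of (g,f). *)
Let K_inj a b c d : (forall z, a * g z - b * f z = c * g z - d * f z) ->
  a = c /\ b = d.
Proof.
move=> e; have [z|-> /eqP] := independent_coef _ _ a (- b) c (- d) indep.
  by rewrite !mulNr.
by rewrite eqr_opp => /eqP.
Qed.

Let comm x y : g (x * y)%g = g (y * x)%g /\ f (x * y)%g = f (y * x)%g.
Proof.
apply: K_inj => z; rewrite -!/(K _ _) -!F_sigma.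
by rewrite -[RHS]F_cyc F_cyc F_sym3 -F_cyc.
Qed.

(** The coordinates of (g,f) in the basis of kappa = (1, alpha) and
    w0 = (g z0, f z0).  As kappa represents the linear form F, it acts as a unit
    and multiplication in S becomes multiplication in the algebra
    C[T] / (T^2 - t T - d), with p + r T the image of a point. *)
Lemma quadratic_structure : exists p r : S -> R[i], exists g0 f0 t d : R[i],
  [/\ forall x, g x = p x + g0 * r x,
      forall x, f x = alpha * p x + f0 * r x,
      forall x y, p (x * y)%g = p x * p y + d * (r x * r y) &
      forall x y, r (x * y)%g = p x * r y + r x * p y + t * (r x * r y)].
Proof.
(* a point whose value is independent of kappa *)
have [z0 nz] : exists z0, f z0 - alpha * g z0 != 0.
  have [z1 [z2 nz]] := indep; have [e|] := eqVneq (f z1 - alpha * g z1) 0.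
    exists z2; apply: contra_neq nz => e'.
    by apply: (eq_of_lincomb2 _ _ _ _ (- g z2) (g z1) _ _ e e'); ring.
  by exists z1.
pose r x : R[i] := (f x - alpha * g x) / (f z0 - alpha * g z0).
pose p x : R[i] := g x - g z0 * r x.
have gE x : g x = p x + g z0 * r x by rewrite /p; ring.
have fE x : f x = alpha * p x + f z0 * r x by rewrite /p /r; field.
have r0 : r z0 = 1 by rewrite /r; field.
have p0 : p z0 = 0 by rewrite /p r0; ring.
(* Pair both sides with w x.  Symmetry of F on triple products gives
   K (w (y z), w x) = K (w y, w (x sigma(z))); expand w y = p y kappa + r y w0
   and use K (kappa, w (x sigma(z))) = F (x sigma(z)) = K (w z, w x). *)
have step y z : g (y * z)%g = p y * g z + r y * g (z0 * z)%g /\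
                f (y * z)%g = p y * f z + r y * f (z0 * z)%g.
  apply: K_inj => x; rewrite -/(K _ _).
  transitivity (p y * K z x + r y * K (z0 * z)%g x); last by rewrite /K; ring.
  have KE u : K (u * z)%g x = K u (x * sigma z)%g.
    by rewrite -!F_sigma sigmaM sigmaK mulgA F_sym3.
  rewrite !KE K_sym (K_sym z) -(F_sigma x) /F {1}/K.
  by rewrite K_sym /K {1}(gE y) {1}(fE y); ring.
have rM y z : r (y * z)%g = p y * r z + r y * r (z0 * z)%g.
  by rewrite {1}/r; have [-> ->] := step y z; rewrite /p /r; field.
have pM y z : p (y * z)%g = p y * p z + r y * p (z0 * z)%g.
  by rewrite {1}/p rM; have [-> _] := step y z; rewrite /p; ring.
have rC z : r (z0 * z)%g = r (z * z0)%g.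
  by rewrite /r; have [-> ->] := comm z0 z.
have pC z : p (z0 * z)%g = p (z * z0)%g.
  by rewrite /p rC; have [-> _] := comm z0 z.
exists p, r, (g z0), (f z0), (r (z0 * z0)%g), (p (z0 * z0)%g).
split=> // y z.
- by rewrite pM pC pM p0; ring.
- by rewrite rM rC rM r0; ring.
Qed.

(** Each root l of T^2 = t T + d yields the character p + l r.  Two distinct
    roots give two characters; a double root t / 2 gives one character chi, and
    then r satisfies the sine addition law for chi. *)
Lemma spectral_form :
  (exists chi1 chi2 a b,
    [/\ multiplicative_fun chi1, multiplicative_fun chi2,
        independent chi1 chi2,
        forall x, g x = a * chi1 x + (1 - a) * chi2 x &
        forall x, f x = b * chi1 x + (alpha - b) * chi2 x]) \/
  (exists chi r a b,
    [/\ multiplicative_fun chi,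
        sine_law chi r,
        independent chi r,
        forall x, g x = chi x + a * r x &
        forall x, f x = alpha * chi x + b * r x]).
Proof.
have [p [r [g0 [f0 [t [d [gE fE pM rM]]]]]]] := quadratic_structure.
have ipr : independent p r.
  by apply: (independent_change _ _ _ _ 1 g0 alpha f0 _ _ indep) => x;
    rewrite ?mul1r.
(* a square root of the discriminant *)
pose s := sqrtC (t ^+ 2 + 4 * d).
have s2 : s ^+ 2 = t ^+ 2 + 4 * d by rewrite sqrtCK.
have [s0|s_nz] := eqVneq s 0.
  right; exists (fun x => p x + t / 2 * r x), r.
  exists (g0 - t / 2), (f0 - alpha * (t / 2)).
  have dE : d = - (t / 2) ^+ 2.
    move: s2; rewrite s0 => s2.
    by apply: (eq_of_lincomb1 _ _ (- 1 / 4) _ _ s2); field.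
  split.
  - by move=> x y; rewrite pM rM dE; field.
  - by move=> x y; rewrite rM; field.
  - by apply: (independent_change _ _ _ _ 1 (- (t / 2)) 0 1 _ _ ipr) => x; ring.
  - by move=> x; rewrite gE; ring.
  - by move=> x; rewrite fE; ring.
left; pose l1 := (t + s) / 2; pose l2 := (t - s) / 2.
have mul l : l ^+ 2 = t * l + d -> multiplicative_fun (fun x => p x + l * r x).
  move=> lE x y; rewrite pM rM.
  by apply: (eq_of_lincomb1 _ _ (- (r x * r y)) _ _ lE); ring.
exists (fun x => p x + l1 * r x), (fun x => p x + l2 * r x).
exists ((g0 - l2) / s), ((f0 - alpha * l2) / s).
split.
- by apply: mul; apply: (eq_of_lincomb1 _ _ (1 / 4) _ _ s2); rewrite /l1; field.
- by apply: mul; apply: (eq_of_lincomb1 _ _ (1 / 4) _ _ s2); rewrite /l2; field.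
- apply: (independent_change _ _ _ _ (- l2 / s) (l1 / s) (1 / s) (- 1 / s)
           _ _ ipr) => x; rewrite /l1 /l2; by field.
- by move=> x; rewrite gE /l1 /l2; field.
- by move=> x; rewrite fE /l1 /l2; field.
Qed.

End Structure.

(** * Proportional components *)

Section Classification.
Context {R : realType} {S : semigroupType}.
Implicit Types (sigma : S -> S) (g f chi h u v w : S -> R[i]) (alpha q : R[i]).

Lemma sqr_eq_sign (x y : R[i]) : x ^+ 2 = y ^+ 2 ->
  exists b : bool, x = (-1) ^+ b * y.
Proof.
move=> /eqP; rewrite eqf_sqr => /orP[] /eqP ->.
  by exists false; rewrite mul1r.
by exists true; rewrite mulN1r.
Qed.

Lemma multiplicative_star sigma chi : involutive_automorphism sigma ->
  multiplicative_fun chi -> multiplicative_fun (star sigma chi).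
Proof. by move=> [sM _] chiM x y; rewrite /star /= sM chiM. Qed.

(** With g = m w and f = l w the equation becomes
    (m - alpha l) w (x sigma(y)) = (m^2 - l^2) w x w y.  If the left
    coefficient vanishes then so does the right one, and alpha^2 = 1; if only the
    right one does, w vanishes on products; otherwise a multiple of w is an even
    character. *)
Lemma dependent_solution sigma alpha g f : inhabited S ->
  involutive_automorphism sigma -> solution sigma alpha g f ->
  ~ independent g f ->
  family1 alpha g f \/ families2to8 sigma alpha g f.
Proof.
move=> [x0] sigmaP sol /dependent_multiple[[-> ->]|].
  (* The zero solution lies in family 4: q = - alpha makes the square root 1,
     which the minus sign cancels. *)
  right; right; right; left; exists (- alpha), true, (cst 1).
  split=> //.
  - by move=> /(congr1 (@^~ x0)) /eqP; rewrite /cst /= oner_eq0.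
  - by move=> x y; rewrite mulr1.
  - by move=> x; rewrite /cst /=; ring.
  - move=> x; rewrite /cst /= sqrrN addrK sqrtC1; ring.
move=> [w [m [l [w0 ml gE fE]]]].
have [sM sK] := sigmaP.
have e x y : (m - alpha * l) * w (x * sigma y)%g =
             (m ^+ 2 - l ^+ 2) * (w x * w y).
  have := sol x y; rewrite !gE !fE => e.
  by apply: (eq_of_lincomb1 _ _ 1 _ _ e); ring.
have [x1 wx1] := nonzero_fun_witness _ w0.
have [mE|nz] := eqVneq (m - alpha * l) 0.
  have m2 : m ^+ 2 = l ^+ 2.
    have := e x1 x1; rewrite mE mul0r => /esym/eqP.
    by rewrite !mulf_eq0 (negPf wx1) !orbF subr_eq0 => /eqP.
  move/eqP: mE; rewrite subr_eq0 => /eqP mE.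
  have l0 : l != 0.
    apply/eqP => l0; case: ml => /eqP //; apply.
    by rewrite mE l0 mulr0.
  left; split.
  - have : alpha ^+ 2 == 1 ^+ 2.
      apply/eqP/(mulIf (expf_neq0 2 l0)).
      by rewrite -exprMn -mE m2; ring.
    by rewrite eqf_sqr => /orP[] /eqP ->; [left|right].
  - move=> f0; move/eqP: (congr1 (@^~ x1) f0).
    by rewrite fE mulf_eq0 (negPf l0) (negPf wx1).
  - by move=> x; rewrite gE fE mE mulrA.
have [m2|nz2] := eqVneq (m ^+ 2 - l ^+ 2) 0.
  have w2 x : sqr_set setT x -> w x = 0.
    move=> [y _ [z _ <-]]; apply: (mulfI nz).
    by rewrite mulr0 -(sK z) e m2 mul0r.
  have m0 : m != 0.
    apply/eqP => m0; move/eqP: m2; rewrite m0 expr0n sub0r oppr_eq0 sqrf_eq0.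
    by move=> /eqP l0; case: ml; rewrite ?m0 ?l0 eqxx.
  have g0 : g <> cst 0.
    move=> g0; move/eqP: (congr1 (@^~ x1) g0).
    by rewrite gE mulf_eq0 (negPf m0) (negPf wx1).
  have g2 x : sqr_set setT x -> g x = 0 by move=> /w2 h; rewrite gE h mulr0.
  move/eqP: m2; rewrite subr_eq0 eqf_sqr => /orP[] /eqP mE.
    right; left; split=> //.
      by move=> a1; move: nz; rewrite a1 mE mul1r subrr eqxx.
    by apply/funext => x; rewrite gE fE mE.
  right; right; left; split=> //.
    by move=> a1; move: nz; rewrite a1 mE mulN1r opprK addNr eqxx.
  by move=> x; rewrite gE fE mE mulNr opprK.
pose c := (m ^+ 2 - l ^+ 2) / (m - alpha * l).
have c0 : c != 0 by rewrite mulf_neq0 ?invr_eq0.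
pose chi x := c * w x.
have chiE x y : chi (x * sigma y)%g = chi x * chi y.
  apply: (mulfI nz); rewrite /chi mulrCA e /c; by field.
have chi_x1 : chi x1 != 0 by rewrite mulf_neq0.
have chiE' x y : chi (x * y)%g = chi x * chi (sigma y) by rewrite -chiE sK.
(* Compare the two bracketings of x1 (sigma(x1) z). *)
have chi_even z : chi z = chi (sigma z).
  apply: (mulfI (mulf_neq0 chi_x1 chi_x1)).
  have := congr1 chi (mulgA x1 (sigma x1) z).
  by rewrite !chiE' sM !chiE' !sK mulrA => ->.
right; right; right; left.
pose m' := m / c; pose l' := l / c.
have ml' : m' - alpha * l' = m' ^+ 2 - l' ^+ 2.
  apply: (mulIf (mulf_neq0 c0 c0)); transitivity (c * (m - alpha * l)).
    by rewrite /m' /l'; field.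
  transitivity (m ^+ 2 - l ^+ 2); last by rewrite /m' /l'; field.
  by rewrite /c; field.
(* Completing the square in ml' gives (2 m' - 1)^2 = 1 + q^2 - alpha^2. *)
pose q := 2 * l' - alpha.
have [b bE] : exists b : bool, 2 * m' - 1 =
    (-1) ^+ b * sqrtC (1 + q ^+ 2 - alpha ^+ 2).
  apply: sqr_eq_sign; rewrite sqrtCK.
  by apply: (eq_of_lincomb1 _ _ (- 4) _ _ ml'); rewrite /q; ring.
exists q, b, chi; split.
- by move=> /(congr1 (@^~ x1)) /eqP; rewrite (negPf chi_x1).
- by move=> x y; rewrite chiE' -chi_even.
- by apply/funext.
- by move=> x; rewrite fE /chi /q /l'; field.
- by move=> x; rewrite -bE gE /chi /m'; field.
Qed.

(** * Two characters *)

(** A character in the span of two characters is one of them or zero. *)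
Lemma multiplicative_comb chi1 chi2 mu (a b : R[i]) :
  multiplicative_fun chi1 -> multiplicative_fun chi2 ->
  independent chi1 chi2 -> multiplicative_fun mu ->
  (forall x, mu x = a * chi1 x + b * chi2 x) ->
  [/\ a * a = a, a * b = 0 & b * b = b].
Proof.
move=> m1 m2 ind m e.
have e1 x : a * chi1 x = mu x * a /\ b * chi2 x = mu x * b.
  apply: (independent_coef _ _ _ _ _ _ ind) => y.
  by rewrite -!mulrA -m1 -m2 -e m -mulrDr -e.
have [aa _] : a * a = a /\ a * b = 0.
  apply: (independent_coef _ _ _ _ _ _ ind) => x.
  by rewrite mul0r addr0 (e1 x).1 e; ring.
have [ab bb] : a * b = 0 /\ b * b = b.
  apply: (independent_coef _ _ _ _ _ _ ind) => x.
  by rewrite mul0r add0r (e1 x).2 e; ring.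
by split.
Qed.

(** The function chi1 o sigma is again a nonzero character and it lies in the
    span of chi1 and chi2, so it is chi1 or chi2; which one is read off from m. *)
Lemma star_eq_of_comb sigma chi1 chi2 (F m : R[i]) :
  involutive_automorphism sigma ->
  multiplicative_fun chi1 -> multiplicative_fun chi2 ->
  independent chi1 chi2 -> F != 0 ->
  (forall y, F * chi1 (sigma y) = (F - m) * chi1 y + m * chi2 y) ->
  (m = 0 /\ star sigma chi1 = chi1) \/ (m = F /\ star sigma chi1 = chi2).
Proof.
move=> sigmaP m1 m2 ind F0 e.
have e' y : star sigma chi1 y = (F - m) / F * chi1 y + m / F * chi2 y.
  by apply: (mulfI F0); rewrite /star /= e; field.
have [_ ab bb] := multiplicative_comb _ _ _ _ _ m1 m2 ind
  (multiplicative_star _ _ sigmaP m1) e'.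
have [m0|m_nz] := eqVneq m 0.
  left; split=> //; apply/funext => y.
  by rewrite e' m0; field.
have mF : m = F.
  by apply: (mulIf m_nz); apply: (eq_of_lincomb1 _ _ (F ^+ 2) _ _ bb); field.
right; split=> //; apply/funext => y.
by rewrite e' mF; field.
Qed.

(** The left side of the conclusion is K(v, kappa) for the vector v = (a, b),
    and the second hypothesis says K(v, v) = 0.  A null vector of a
    nondegenerate plane orthogonal to kappa is proportional to kappa or
    zero, which the first hypothesis forbids. *)
Lemma norm_coef_neq0 (alpha a b : R[i]) : a * alpha != b ->
  a ^+ 2 - b ^+ 2 = 0 -> a - alpha * b != 0.
Proof.
move=> det e; apply: contra_neq det => e0.
apply/eqP; rewrite -subr_eq0 -sqrf_eq0; apply/eqP.
by apply: (eq_of_lincomb2 _ _ _ _ (alpha ^+ 2 - 1)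
  (alpha * (alpha * a - b) - (alpha ^+ 2 - 1) * a) _ _ e e0); ring.
Qed.

Lemma two_character_solution sigma alpha g f chi1 chi2 (a b : R[i]) :
  involutive_automorphism sigma -> solution sigma alpha g f ->
  independent g f ->
  multiplicative_fun chi1 -> multiplicative_fun chi2 ->
  independent chi1 chi2 ->
  (forall x, g x = a * chi1 x + (1 - a) * chi2 x) ->
  (forall x, f x = b * chi1 x + (alpha - b) * chi2 x) ->
  families2to8 sigma alpha g f.
Proof.
move=> sigmaP sol igf M1 M2 ind gE fE.
have det : a * alpha != b.
  rewrite -subr_eq0; have [z1 [z2]] := igf; apply: contra_neq => e.
  apply/eqP; rewrite -[0](mul0r (chi1 z1 * chi2 z2 - chi1 z2 * chi2 z1)) -e.
  by rewrite !gE !fE; apply/eqP; ring.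
have [nz1 nz2] := independent_nonzero _ _ ind.
have neq12 := independent_neq _ _ ind.
(* For v1 = (a, b) and v2 = kappa - v1: m = K(v1, v2) and Fi = K(vi, kappa),
   hence K(vi, vi) = Fi - m. *)
pose m := a * (1 - a) - b * (alpha - b).
pose F1 := a - alpha * b; pose F2 := (1 - a) - alpha * (alpha - b).
have star12 y : F1 * chi1 (sigma y) = (F1 - m) * chi1 y + m * chi2 y /\
                F2 * chi2 (sigma y) = (F2 - m) * chi2 y + m * chi1 y.
  apply: (independent_coef _ _ _ _ _ _ ind) => x.
  have := sol x y; rewrite !gE !fE M1 M2 => e.
  by apply: (eq_of_lincomb1 _ _ 1 _ _ e); rewrite /F1 /F2 /m; ring.
have ind21 : independent chi2 chi1.
  by apply: (independent_change _ _ _ _ 0 1 1 0 _ _ ind) => x; ring.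
have F_neq0 (c d F : R[i]) (chi chi' : S -> R[i]) :
    independent chi chi' -> c * alpha != d -> F = c - alpha * d ->
    F - m = c ^+ 2 - d ^+ 2 ->
    (forall y, F * chi (sigma y) = (F - m) * chi y + m * chi' y) -> F != 0.
  move=> ind' det' FE Fm e; apply/eqP => F0.
  have [_ m0] : F - m = 0 /\ m = 0.
    apply: (independent_coef _ _ _ _ _ _ ind') => y.
    by rewrite -e F0 !mul0r addr0.
  suff: F != 0 by rewrite F0 eqxx.
  by rewrite FE; apply: norm_coef_neq0 => //; rewrite -Fm m0 F0 subr0.
have F10 : F1 != 0.
  apply: (F_neq0 a b _ _ _ ind det erefl _ (fun y => (star12 y).1)).
  by rewrite /F1 /m; ring.
have F20 : F2 != 0.
  apply: (F_neq0 (1 - a) (alpha - b) _ _ _ ind21 _ erefl _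
            (fun y => (star12 y).2)).
    by apply: contra_neq det => e; apply: (eq_of_lincomb1 _ _ (-1) _ _ e); ring.
  by rewrite /F2 /m; ring.
have [[m0 e1]|[mF1 e1]] := star_eq_of_comb _ _ _ _ _ sigmaP M1 M2 ind F10
    (fun y => (star12 y).1); last first.
  have [[m0 _]|[mF2 e2]] := star_eq_of_comb _ _ _ _ _ sigmaP M2 M1 ind21 F20
    (fun y => (star12 y).2); first by case/eqP: F10; rewrite -mF1.
  do 6!right.
  have /eqP : a ^+ 2 = b ^+ 2.
    by apply: (eq_of_lincomb1 _ _ (-1) _ _ mF1); rewrite /m /F1; ring.
  have /eqP : (1 - a) ^+ 2 = (alpha - b) ^+ 2.
    by apply: (eq_of_lincomb1 _ _ (-1) _ _ mF2); rewrite /m /F2; ring.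
  have sgn (c : R[i]) : (1 - c) * (1 + c) != 0 -> c <> 1 /\ c <> -1.
    by move=> nz; split=> e; move: nz; rewrite e ?subrr ?addrN ?mul0r ?mulr0 eqxx.
  rewrite !eqf_sqr => /orP[] /eqP eb /orP[] /eqP ea.
  - case/eqP: det.
    by apply: (eq_of_lincomb2 _ _ _ _ (1 - a) (- a) _ _ ea eb); ring.
  - have bE : b = - (1 - alpha) / 2.
      by apply: (eq_of_lincomb2 _ _ _ _ (1 / 2) (1 / 2) _ _ ea eb); field.
    have aE : a = (1 - alpha) / 2 by rewrite ea bE; field.
    exists chi2; rewrite e2; split=> //.
    + by apply: sgn; apply: contra_neq F10 => e; rewrite /F1 aE bE;
        apply: (eq_of_lincomb1 _ _ (1 / 2) _ _ e); field.
    + by move=> e; apply: neq12.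
    + by move=> x; rewrite fE bE; field.
    + by move=> x; rewrite gE aE; field.
  - have bE : b = (1 + alpha) / 2.
      by apply: (eq_of_lincomb2 _ _ _ _ (- 1 / 2) (- 1 / 2) _ _ ea eb); field.
    have aE : a = (1 + alpha) / 2 by rewrite ea bE.
    exists chi1; rewrite e1; split=> //.
    + by apply: sgn; apply: contra_neq F10 => e; rewrite /F1 aE bE;
        apply: (eq_of_lincomb1 _ _ (1 / 2) _ _ e); field.
    + by move=> x; rewrite fE bE; field.
    + by move=> x; rewrite gE aE; field.
  - case/eqP: det.
    by apply: (eq_of_lincomb2 _ _ _ _ (a - 1) a _ _ ea eb); ring.
(* From here on m = 0 and sigma fixes both characters; before, m = F1 = F2
   made v1 and v2 null vectors and sigma exchanged the characters. *)
have [[_ e2]|[mF2 _]] := star_eq_of_comb _ _ _ _ _ sigmaP M2 M1 ind21 F20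
    (fun y => (star12 y).2); last by case/eqP: F20; rewrite -mF2.
pose q := 2 * b - alpha.
have e_m : a * (1 - a) = b * (alpha - b) by apply/subr0_eq.
have [s sE] : exists s : bool, 2 * a - 1 =
    (-1) ^+ s * sqrtC (1 + q ^+ 2 - alpha ^+ 2).
  apply: sqr_eq_sign; rewrite sqrtCK.
  by apply: (eq_of_lincomb1 _ _ (- 4) _ _ e_m); rewrite /q; ring.
(* If q = alpha or q = - alpha then f is a multiple of one character, and g must
   be the other one since f and g are independent. *)
have [qa|qa] := eqVneq q alpha.
  have bE : b = alpha.
    by apply: (eq_of_lincomb1 _ _ (1 / 2) _ _ qa); rewrite /q; field.
  have aE : a = 0.
    move/eqP: e_m; rewrite bE subrr mulr0 mulf_eq0 subr_eq0 => /orP[/eqP//|/eqP a1].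
    by case/eqP: det; rewrite -a1 bE mul1r.
  do 4!right; left; exists chi1, chi2; split=> //.
  - by split=> // alpha0; case/eqP: det; rewrite bE alpha0 mulr0.
  - by move=> x; rewrite fE bE; ring.
  - by apply/funext => x; rewrite gE aE; ring.
have [qb|qb] := eqVneq q (- alpha).
  have bE : b = 0.
    by apply: (eq_of_lincomb1 _ _ (1 / 2) _ _ qb); rewrite /q; field.
  have aE : a = 1.
    move/eqP: e_m; rewrite bE mul0r mulf_eq0 subr_eq0 => /orP[/eqP a0|/eqP//].
    by case/eqP: det; rewrite a0 bE mul0r.
  do 4!right; left; exists chi2, chi1; split=> //.
  - split; last exact: nesym.
    by move=> alpha0; case/eqP: det; rewrite bE alpha0 mulr0.
  - by move=> x; rewrite fE bE; ring.
  - by apply/funext => x; rewrite gE aE; ring.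
do 3!right; left; exists q, s, chi1, chi2; split=> //.
- by split=> //; split; apply/eqP.
- by move=> x; rewrite fE /q; field.
- by move=> x; rewrite -sE gE; field.
Qed.

(** * The sine addition law *)

(** A solution h of the sine addition law vanishes on the square of the null
    ideal I, and for p in I and u, v outside I the numbers h (u p), h (p v),
    h (u p v) are nonzero multiples of h p.  So h p <> 0 forces p into P_chi,
    and h is of the form prescribed by [h_fun] with A = h / chi. *)
Lemma sine_law_h_fun chi h : multiplicative_fun chi -> sine_law chi h ->
  let h' := h_fun chi (fun x => h x / chi x) h in
  [/\ h' = h, additive_on (~` I_ chi) (fun x => h x / chi x),
      condition_I chi h & condition_II chi h].
Proof.
move=> chiM hS h'.
have hII x : sqr_set (I_ chi) x -> h x = 0.
  by move=> [a ia [b ib <-]]; rewrite hS ia ib mulr0 mul0r addr0.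
have hIP x : I_ chi x -> ~ P_ chi x -> h x = 0.
  move=> ix nPx; have [?|n2] := pselect (sqr_set (I_ chi) x); first exact: hII.
  apply: contrapT => hx; apply: nPx; split=> // u v iu iv.
  have notI2 y : chi y = 0 -> h y <> 0 -> (I_ chi `\` sqr_set (I_ chi)) y.
    by move=> y0 hy; split=> // /hII.
  have nz a b : a <> 0 -> b <> 0 -> a * b <> 0 :> R[i].
    by move=> /eqP a0 /eqP b0; apply/eqP; rewrite mulf_neq0.
  split; apply: notI2; rewrite ?hS ?chiM ?ix ?mulr0 ?mul0r //.
  - by rewrite add0r; apply: nz.
  - by rewrite addr0; apply: nz.
  - by rewrite add0r addr0; apply: (nz) => //; apply: nz.
have h'E : h' = h.
  apply/funext => x; rewrite /h' /h_fun; case: ifPn => [|/negP].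
    by rewrite in_setE => /eqP nz; field.
  rewrite in_setE => /contrapT ix; case: ifPn => // /negP.
  by rewrite in_setE => /(hIP _ ix).
split=> //.
- move=> x y /eqP nx /eqP ny; rewrite hS chiM; field.
  by rewrite nx ny.
- by move=> p u v [[ip _] _] _ _; rewrite !hS !chiM ip; split; ring.
- by move=> x y [ix nPx] _; rewrite !hS ix (hIP _ ix nPx); split; ring.
Qed.

(** Here kappa is the coefficient of chi and v = (a, b) that of r.  Comparing
    the coefficients of r x shows that chi o sigma = chi + d r, which is
    multiplicative only if d = 0.  Then K(v, v) = 0, giving a = b or a = - b, and
    the coefficients of chi x show that r is even as well. *)
Lemma character_sine_solution sigma alpha g f chi r (a b : R[i]) :
  involutive_automorphism sigma -> solution sigma alpha g f ->
  independent g f ->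
  multiplicative_fun chi -> sine_law chi r -> independent chi r ->
  (forall x, g x = chi x + a * r x) ->
  (forall x, f x = alpha * chi x + b * r x) ->
  family7 sigma alpha g f.
Proof.
move=> sigmaP sol igf chiM rS ind gE fE.
have [sM sK] := sigmaP.
have [chi0 r0] := independent_nonzero _ _ ind.
have det : b - alpha * a != 0.
  have [z1 [z2]] := igf; apply: contra_neq => e.
  rewrite -[RHS](mul0r (chi z1 * r z2 - chi z2 * r z1)) -e.
  by rewrite !gE !fE; ring.
have star_rel y :
    (1 - alpha ^+ 2) * chi (sigma y) + (a - alpha * b) * r (sigma y) =
    (1 - alpha ^+ 2) * chi y + (a - alpha * b) * r y /\
    (a - alpha * b) * chi (sigma y) =
    (a - alpha * b) * chi y + (a ^+ 2 - b ^+ 2) * r y.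
  apply: (independent_coef _ _ _ _ _ _ ind) => x.
  have := sol x y; rewrite !gE !fE rS chiM => e.
  by apply: (eq_of_lincomb1 _ _ 1 _ _ e); ring.
pose F := a - alpha * b.
have F0 : F != 0.
  apply/eqP => F0.
  have [_ B0] : F = 0 /\ a ^+ 2 - b ^+ 2 = 0.
    apply: (independent_coef _ _ _ _ _ _ ind) => y.
    by rewrite -(star_rel y).2 -/F F0 !mul0r addr0.
  move/eqP: F0; apply/negP; apply: norm_coef_neq0 => //.
  by apply: contra_neq det => <-; ring.
pose d := (a ^+ 2 - b ^+ 2) / F.
have chi_star y : chi (sigma y) = chi y + d * r y.
  by apply: (mulfI F0); rewrite (star_rel y).2 /d /F; field.
(* In (chi + d r)(x^2) = ((chi + d r) x)^2 only the term d^2 (r x)^2 fails to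
   cancel. *)
have d0 : d = 0.
  have [x rx] := nonzero_fun_witness _ r0.
  have := chi_star (x * x)%g; rewrite sM rS !chiM !chi_star => e.
  apply/eqP; rewrite -sqrf_eq0; apply/eqP.
  apply: (mulIf (mulf_neq0 rx rx)).
  by apply: (eq_of_lincomb1 _ _ 1 _ _ e); ring.
have chi_even y : chi (sigma y) = chi y by rewrite chi_star d0 mul0r addr0.
have r_even y : r (sigma y) = r y.
  apply: (mulfI F0); have := (star_rel y).1.
  by rewrite chi_even => /addrI.
have /sqr_eq_sign[s sE] : a ^+ 2 = b ^+ 2.
  by move/eqP: d0; rewrite mulf_eq0 invr_eq0 (negPf F0) orbF subr_eq0 => /eqP.
pose h x := b * r x.
have hS : sine_law chi h by move=> x y; rewrite /h rS; ring.
have [h'E hA hI hII] := sine_law_h_fun _ _ chiM hS.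
exists s, chi, (fun x => h x / chi x), h; rewrite /= h'E; split=> //.
- by split=> //; apply/funext => x; rewrite /star /= chi_even.
- by split=> // x _; rewrite /h chi_even r_even.
- by move=> x _; rewrite /h r_even.
- by split=> x; rewrite ?fE // gE sE mulrA.
Qed.

(** P_chi is stable under multiplication by elements outside the null ideal,
    since these elements form a subsemigroup. *)
Lemma P_translate chi (p u : S) : multiplicative_fun chi ->
  P_ chi p -> chi u <> 0 -> P_ chi (u * p)%g /\ P_ chi (p * u)%g.
Proof.
move=> chiM [_ Pp] u0.
have nzM a b : chi a <> 0 -> chi b <> 0 -> chi (a * b)%g <> 0.
  by move=> /eqP a0 /eqP b0; apply/eqP; rewrite chiM mulf_neq0.
split; split.
- by have [] := Pp u u u0 u0.
- move=> a b a0 b0; have := Pp _ _ (nzM _ _ a0 u0) b0; have := Pp _ _ u0 b0.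
  by rewrite !mulgA => -[_ _ ?] [].
- by have [] := Pp u u u0 u0.
- move=> a b a0 b0; have := Pp _ _ a0 (nzM _ _ u0 b0); have := Pp _ _ a0 u0.
  by rewrite !mulgA => -[_ _ ?] [].
Qed.

Lemma h_fun_unit chi A rho x : chi x <> 0 -> h_fun chi A rho x = chi x * A x.
Proof. by move=> x0; rewrite /h_fun mem_set. Qed.

Lemma h_fun_P chi A rho x : P_ chi x -> h_fun chi A rho x = rho x.
Proof.
by move=> Px; rewrite /h_fun memNset ?mem_set // => /(_ Px.1.1).
Qed.

Lemma h_fun_other chi A rho x : chi x = 0 -> ~ P_ chi x ->
  h_fun chi A rho x = 0.
Proof. by move=> x0 nPx; rewrite /h_fun !memNset // => /(_ x0). Qed.

(** The converse of [sine_law_h_fun].  For two arguments in the null ideal both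
    sides vanish, as P_chi contains no product of elements of that ideal;
    conditions (I) and (II) are the mixed case and additivity of A the
    remaining one. *)
Lemma h_fun_sine_law chi A rho :
  multiplicative_fun chi -> additive_on (~` I_ chi) A ->
  condition_I chi rho -> condition_II chi (h_fun chi A rho) ->
  sine_law chi (h_fun chi A rho).
Proof.
move=> chiM addA hI hII x y; set h := h_fun _ _ _.
have mixed (p u : S) : chi p = 0 -> chi u <> 0 ->
    h (p * u)%g = h p * chi u /\ h (u * p)%g = h p * chi u.
  move=> p0 u0; have [Pp|nPp] := pselect (P_ chi p).
    have [Pup Ppu] := P_translate _ _ _ chiM Pp u0.
    by rewrite /h !h_fun_P //; have [] := hI _ _ _ Pp u0 u0.
  have [e1 e2] := hII p u (conj p0 nPp) u0.
  by rewrite /h e1 e2 h_fun_other // mul0r.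
have [/eqP x0|/eqP x0] := boolP (chi x == 0).
  have [/eqP y0|/eqP y0] := boolP (chi y == 0).
    rewrite x0 y0 mulr0 mul0r addr0 /h h_fun_other // ?chiM ?x0 ?mul0r //.
    by move=> [[_ n2] _]; apply: n2; exists x => //; exists y.
  by rewrite (mixed _ _ x0 y0).1 x0 mul0r addr0.
have [/eqP y0|/eqP y0] := boolP (chi y == 0).
  by rewrite (mixed _ _ y0 x0).2 y0 mulr0 add0r mulrC.
rewrite /h !h_fun_unit //; last first.
  by apply/eqP; rewrite chiM mulf_neq0 //; apply/eqP.
by rewrite addA // chiM; ring.
Qed.

Lemma P_sigma sigma chi p : involutive_automorphism sigma ->
  even_fun sigma chi -> P_ chi p -> P_ chi (sigma p).
Proof.
move=> [sM sK] ev.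
have evE x : chi (sigma x) = chi x by rewrite {2}ev.
have D x : (I_ chi `\` sqr_set (I_ chi)) x ->
    (I_ chi `\` sqr_set (I_ chi)) (sigma x).
  move=> [x0 n2]; split; first by rewrite /I_ /= evE.
  move=> [a a0 [b b0 e]]; apply: n2; exists (sigma a); first by rewrite /I_ /= evE.
  by exists (sigma b); rewrite /I_ /= ?evE // -sM e sK.
move=> [Dp Pp]; split=> [|u v u0 v0]; first exact: D.
have [] := Pp (sigma u) (sigma v); rewrite /setC /I_ /= ?evE //.
by move=> /D + /D + /D; rewrite !sM !sK.
Qed.

Lemma h_fun_even sigma chi A rho : involutive_automorphism sigma ->
  even_fun sigma chi -> invariant_on (~` I_ chi) sigma A ->
  invariant_on (P_ chi) sigma rho ->
  even_fun sigma (h_fun chi A rho).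
Proof.
move=> sigmaP ev evA evr; have [sM sK] := sigmaP.
have evE x : chi (sigma x) = chi x by rewrite {2}ev.
apply/funext => x; rewrite /star /=.
have [/eqP x0|/eqP x0] := boolP (chi x == 0); last first.
  by rewrite !h_fun_unit ?evE // evA.
have [Px|nPx] := pselect (P_ chi x).
  by rewrite !h_fun_P ?evr //; exact: P_sigma.
rewrite !h_fun_other ?evE // => /(P_sigma _ _ _ sigmaP ev).
by rewrite sK.
Qed.

(** * The families are the solutions, and they are abelian *)

Lemma solution_families sigma alpha g f : inhabited S ->
  involutive_automorphism sigma -> solution sigma alpha g f ->
  family1 alpha g f \/ families2to8 sigma alpha g f.
Proof.
move=> inhS sigmaP sol.
have [igf|] := pselect (independent g f); last exact: dependent_solution.
right; have [[chi1 [chi2 [a [b]]]]|[chi [r [a [b]]]]] :=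
  spectral_form sigmaP sol igf.
  move=> [? ? ? ? ?].
  exact: (two_character_solution sigma alpha g f chi1 chi2 a b).
move=> [chiM rS ind gE fE]; do 5!right; left.
exact: (character_sine_solution sigma alpha g f chi r a b).
Qed.

Lemma families_solution sigma alpha g f :
  involutive_automorphism sigma ->
  family1 alpha g f \/ families2to8 sigma alpha g f ->
  solution sigma alpha g f.
Proof.
move=> sigmaP; have [sM sK] := sigmaP.
have evE chi : even_fun sigma chi -> forall y, chi (sigma y) = chi y.
  by move=> e y; rewrite {2}e.
have sqrS x y : sqr_set setT (x * sigma y)%g by exists x => //; exists (sigma y).
case=> [[a1 _ gE]|[|[|[|[|[|[|]]]]]]].
- have a2 : alpha ^+ 2 = 1 by case: a1 => ->; rewrite ?sqrrN expr1n.
  move=> x y; rewrite !gE; apply: (eq_of_lincomb1 _ _ (- (f x * f y)) _ _ a2); ring.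
- by move=> [_ -> _ g2] x y; rewrite g2 //; ring.
- by move=> [_ fE _ g2] x y; rewrite !fE g2 //; ring.
- move=> [q [b [chi [_ chiM ev fE gE]]]] x y.
  rewrite !gE !fE chiM evE //; set s := _ * sqrtC _.
  have s2 : s ^+ 2 = 1 + q ^+ 2 - alpha ^+ 2.
    by rewrite /s exprMn sqrr_sign mul1r sqrtCK.
  by apply: (eq_of_lincomb1 _ _ (- chi x * chi y / 4) _ _ s2); field.
- move=> [q [b [chi1 [chi2 [_ [_ M1 e1] [_ M2 e2] fE gE]]]]] x y.
  rewrite !gE !fE M1 M2 !evE //; set s := _ * sqrtC _.
  have s2 : s ^+ 2 = 1 + q ^+ 2 - alpha ^+ 2.
    by rewrite /s exprMn sqrr_sign mul1r sqrtCK.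
  by apply: (eq_of_lincomb1 _ _ (- ((chi1 x - chi2 x) * (chi1 y - chi2 y)) / 4)
              _ _ s2); field.
- move=> [chi1 [chi2 [_ [_ M1 e1] [_ M2 e2] fE ->]]] x y.
  by rewrite !fE M1 M2 !evE //; ring.
- move=> [b [chi [A [rho]]]] /= [[_ chiM ev] [addA evA] evr [hI hII] [fE gE]] x y.
  have hS := h_fun_sine_law _ _ _ chiM addA hI hII.
  have hev := h_fun_even _ _ _ _ sigmaP ev evA evr.
  rewrite !gE !fE hS chiM !evE // ?(evE _ hev).
  by case: b gE => _; rewrite ?expr1 ?expr0; ring.
- move=> [chi [_ chiM _ fE gE]] x y.
  by rewrite !gE !fE /star /= sM !chiM sK; field.
Qed.

Lemma abelian_multiplicative chi : multiplicative_fun chi -> abelian_fun chi.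
Proof. by move=> M; split=> [x y|x y z]; rewrite !M; ring. Qed.

Lemma abelian_sine_law chi h : multiplicative_fun chi -> sine_law chi h ->
  abelian_fun h.
Proof. by move=> M hS; split=> [x y|x y z]; rewrite !(hS, M); ring. Qed.

Lemma abelian_comb u v w (a b : R[i]) : abelian_fun u -> abelian_fun v ->
  (forall x, w x = a * u x + b * v x) -> abelian_fun w.
Proof.
move=> [u2 u3] [v2 v3] wE.
by split=> [x y|x y z]; rewrite !wE; [rewrite u2 v2|rewrite u3 v3].
Qed.

Lemma abelian_zero_on_products w : (forall x, sqr_set setT x -> w x = 0) ->
  abelian_fun w.
Proof.
move=> w2; have w0 x y : w (x * y)%g = 0 by apply: w2; exists x => //; exists y.
by split=> [x y|x y z]; rewrite !w0.
Qed.

Lemma families_abelian sigma alpha g f : involutive_automorphism sigma ->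
  families2to8 sigma alpha g f -> abelian_fun g /\ abelian_fun f.
Proof.
move=> sigmaP; have abM := abelian_multiplicative.
case=> [|[|[|[|[|[|]]]]]].
- by move=> [_ -> _ /abelian_zero_on_products].
- move=> [_ fE _ g2]; have ag := abelian_zero_on_products _ g2; split=> //.
  by apply: (abelian_comb _ _ _ (-1) 0 ag ag) => x; rewrite fE; ring.
- move=> [q [b [chi [_ /abM ab ev fE gE]]]]; split.
    apply: (abelian_comb _ _ _ _ 0 ab ab) => x; rewrite gE mul0r addr0 mulrC.
    by rewrite -mulrA mulrC.
  by apply: (abelian_comb _ _ _ ((q + alpha) / 2) 0 ab ab) => x; rewrite fE; field.
- move=> [q [b [chi1 [chi2 [_ [_ /abM a1 e1] [_ /abM a2 e2] fE gE]]]]].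
  move: gE; set s := _ * sqrtC _ => gE; split.
    apply: (abelian_comb _ _ _ ((1 + s) / 2) ((1 - s) / 2) a1 a2) => x.
    by rewrite gE; field.
  apply: (abelian_comb _ _ _ ((alpha + q) / 2) ((alpha - q) / 2) a1 a2) => x.
  by rewrite fE; field.
- move=> [chi1 [chi2 [_ [_ /abM a1 e1] [_ /abM a2 e2] fE ->]]]; split=> //.
  by apply: (abelian_comb _ _ _ alpha 0 a1 a1) => x; rewrite fE; ring.
- move=> [b [chi [A [rho]]]] /= [[_ chiM ev] [addA evA] evr [hI hII] [fE gE]].
  have hS := h_fun_sine_law _ _ _ chiM addA hI hII.
  have a1 := abM _ chiM; have a2 := abelian_sine_law _ _ chiM hS; split.
    by apply: (abelian_comb _ _ _ 1 ((-1) ^+ b) a1 a2) => x; rewrite gE mul1r.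
  by apply: (abelian_comb _ _ _ alpha 1 a1 a2) => x; rewrite fE mul1r.
- move=> [chi [_ chiM _ fE gE]].
  have a1 := abM _ chiM; have a2 := abM _ (multiplicative_star _ _ sigmaP chiM).
  split; first by apply: (abelian_comb _ _ _ _ _ a1 a2) => x; rewrite gE.
  by apply: (abelian_comb _ _ _ ((1 + alpha) / 2) (- ((1 - alpha) / 2)) a1 a2)
    => x; rewrite fE mulNr.
Qed.

End Classification.

(** * Continuity *)

Section Continuity.
Context {R : realType} {S : topologicalSemigroupType}.
Implicit Types (u v w chi : S -> R[i]).

Lemma continuousC_comb u v w (a b : R[i]) : continuousC u -> continuousC v ->
  (forall x, w x = a * u x + b * v x) -> continuousC w.
Proof.
move=> cu cv wE; have -> : w = (fun x => a * u x + b * v x) by apply/funext.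
move=> x; apply: (@cvgD R[i] R[i]^o).
  by apply: (@cvgM R[i]); [exact: cvg_cst|exact: cu].
by apply: (@cvgM R[i]); [exact: cvg_cst|exact: cv].
Qed.

Lemma continuousC_translate u y :
  continuousC u -> continuousC (fun x => u (x * y)%g).
Proof.
move=> cu x.
apply: (continuous_comp (f := fun z : S => (z * y)%g)); last exact: cu.
apply: (continuous_comp (f := fun z : S => (z, y))
          (g := fun zy : S * S => (zy.1 * zy.2)%g)).
  by apply: cvg_pair; [exact: cvg_id|exact: cvg_cst].
exact: mulg_continuous.
Qed.

Lemma continuousC_eq_translates u v y (b c : R[i]) : continuousC u -> c != 0 ->
  (forall x, u (x * y)%g - b * u x = c * v x) -> continuousC v.
Proof.
move=> cu c0 e.
apply: (continuousC_comb _ _ _ (1 / c) (- b / c)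
          (continuousC_translate _ y cu) cu) => x.
by apply: (mulfI c0); rewrite -e; field.
Qed.

(** At a point y separating the characters, u (x y) - chi2 y u x is a nonzero
    multiple of chi1 x, and symmetrically for chi2. *)
Lemma continuousC_two_characters u chi1 chi2 (a b : R[i]) :
  multiplicative_fun chi1 -> multiplicative_fun chi2 -> chi1 <> chi2 ->
  a != 0 -> b != 0 -> continuousC u ->
  (forall x, u x = a * chi1 x + b * chi2 x) ->
  continuousC chi1 /\ continuousC chi2.
Proof.
move=> M1 M2 neq a0 b0 cu uE.
have [y] : exists y, chi1 y - chi2 y != 0.
  apply: contrapT => n; apply: neq; apply/funext => y; apply/subr0_eq/eqP.
  by apply: contra_notT n => nz; exists y.
move=> nz; split.
  apply: (continuousC_eq_translates u _ y (chi2 y) (a * (chi1 y - chi2 y)) cu).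
    by rewrite mulf_neq0.
  by move=> x; rewrite !uE M1 M2; ring.
apply: (continuousC_eq_translates u _ y (chi1 y) (b * (chi2 y - chi1 y)) cu).
  by rewrite mulf_neq0 // -opprB oppr_eq0.
by move=> x; rewrite !uE M1 M2; ring.
Qed.

(** Wherever the continuity of g could fail, f is a multiple alpha chi of a
    single character: in family 6, and in family 7 with h = 0.  The hypothesis
    excludes this, and it also gives f <> 0, by taking chi = 0. *)
Lemma families_continuous sigma (alpha : R[i]) (g f : S -> R[i]) :
  involutive_automorphism sigma ->
  family1 alpha g f \/ families2to8 sigma alpha g f -> continuousC f ->
  (forall chi : S -> R[i], multiplicative_fun chi -> continuousC chi ->
     f <> (fun x => alpha * chi x)) ->
  continuousC g.
Proof.
move=> sigmaP fam cf nf.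
have f0 : f <> cst 0.
  move=> f0; apply: (nf (cst 0)).
  - by move=> x y; rewrite mulr0.
  - by move=> x; exact: cvg_cst.
  - by rewrite f0; apply/funext => x; rewrite /cst mulr0.
case: fam => [[_ _ gE]|[|[|[|[|[|[|]]]]]]].
- by apply: (continuousC_comb _ _ _ alpha 0 cf cf) => x; rewrite gE; ring.
- by move=> [_ <-].
- move=> [_ fE _ _].
  by apply: (continuousC_comb _ _ _ (-1) 0 cf cf) => x; rewrite fE; ring.
- move=> [q [b [chi [_ _ _ fE gE]]]].
  have q0 : q + alpha != 0.
    apply/eqP => q0; apply: f0; apply/funext => x.
    by rewrite fE q0 mul0r.
  move: gE; set s := _ * sqrtC _ => gE.
  apply: (continuousC_comb _ _ _ ((1 + s) / (q + alpha)) 0 cf cf) => x.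
  by rewrite gE fE; field.
- move=> [q [b [chi1 [chi2 [[neq [qa qb]] [_ M1 _] [_ M2 _] fE gE]]]]].
  have [||x|c1 c2] := continuousC_two_characters f chi1 chi2
    ((alpha + q) / 2) ((alpha - q) / 2) M1 M2 neq _ _ cf.
  + by rewrite mulf_neq0 ?invr_eq0 ?pnatr_eq0 // addrC addr_eq0; apply/eqP.
  + rewrite mulf_neq0 ?invr_eq0 ?pnatr_eq0 // subr_eq0; apply/eqP => e.
    exact: qa.
  + by rewrite fE; field.
  move: gE; set s := _ * sqrtC _ => gE.
  apply: (continuousC_comb _ _ _ ((1 + s) / 2) ((1 - s) / 2) c1 c2) => x.
  by rewrite gE; field.
- move=> [chi1 [chi2 [[/eqP alpha0 _] [_ M1 _] _ fE _]]].
  case: (nf chi1 M1); last by apply/funext.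
  apply: (continuousC_comb _ _ _ (1 / alpha) 0 cf cf) => x.
  by rewrite fE; field.
- move=> [b [chi [A [rho]]]] /= [[_ chiM _] [addA _] _ [hI hII] [fE gE]].
  have hS := h_fun_sine_law _ _ _ chiM addA hI hII.
  move: fE gE hS; set h := h_fun _ _ _ => fE gE hS.
  have [y hy] : exists y, h y != 0.
    apply: nonzero_fun_witness => h0.
    have fE' x : f x = alpha * chi x by rewrite fE h0 addr0.
    have alpha0 : alpha != 0.
      apply/eqP => alpha0; apply: f0; apply/funext => x.
      by rewrite fE' alpha0 mul0r.
    case: (nf chi chiM); last by apply/funext.
    apply: (continuousC_comb _ _ _ (1 / alpha) 0 cf cf) => x.
    by rewrite fE'; field.
  (* By the sine addition law, f (x y) - chi y f x = chi x h y. *)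
  have cchi : continuousC chi.
    apply: (continuousC_eq_translates f _ y (chi y) (h y) cf hy) => x.
    by rewrite !fE hS chiM; ring.
  apply: (continuousC_comb _ _ _ (1 - (-1) ^+ b * alpha) ((-1) ^+ b) cchi cf).
  by move=> x; rewrite gE fE; ring.
- move=> [chi [[a1 a2] chiM neq fE gE]].
  have [||x|c1 c2] := continuousC_two_characters f chi (star sigma chi)
    ((1 + alpha) / 2) (- ((1 - alpha) / 2)) chiM
    (multiplicative_star _ _ sigmaP chiM) neq _ _ cf.
  + rewrite mulf_neq0 ?invr_eq0 ?pnatr_eq0 // addrC addr_eq0; exact/eqP.
  + rewrite oppr_eq0 mulf_neq0 ?invr_eq0 ?pnatr_eq0 // subr_eq0 eq_sym.
    exact/eqP.
  + by rewrite fE mulNr.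
  exact: (continuousC_comb _ _ _ _ _ c1 c2).
Qed.

End Continuity.

Theorem corollary3p5 (R : realType) :
  (forall (S : semigroupType) (sigma : S -> S) (alpha : R[i]),
    inhabited S -> involutive_automorphism sigma ->
    (forall g f : S -> R[i],
      solution sigma alpha g f <->
      family1 alpha g f \/ families2to8 sigma alpha g f) /\
    (forall g f : S -> R[i],
      families2to8 sigma alpha g f -> abelian_fun g /\ abelian_fun f)) /\
  (forall (S : topologicalSemigroupType) (sigma : S -> S) (alpha : R[i]),
    inhabited S -> involutive_automorphism sigma ->
    forall g f : S -> R[i],
      solution sigma alpha g f ->
      continuousC f ->
      (forall chi : S -> R[i], multiplicative_fun chi -> continuousC chi ->
        f <> (fun x => alpha * chi x)) ->
      continuousC g).
Proof.
split=> [S sigma alpha inhS sigmaP|S sigma alpha inhS sigmaP g f sol cf nf].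
  split=> g f; last exact: families_abelian.
  by split; [exact: solution_families|exact: families_solution].
by apply: (families_continuous sigma alpha g f) => //; exact: solution_families.
Qed.
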